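(* Suppose that the real parameters $(\sigma,\rho,s,\tau,\varepsilon)$ satisfy $$s>0,\quad \sigma>\frac1s,\quad (\sigma s-1)(\rho s-1)-\tau^2\varepsilon^2>0,\quad \varepsilon\in\mathbb{R},\quad \tau\in\mathbb{R}\setminus\{0\},$$ and let $\{w^{k}\}$, $w^k=(x^k,y^k,\lambda^k)$, be the sequence generated by the Parameterized Proximal Point Algorithm (P-PPA) described in the context, from a starting point $w^0=(x^0,y^0,\lambda^0)\in\mathbb{R}^m\times\mathbb{R}^n\times\mathbb{R}^l$. With $u^k=(x^k,y^k)$, for every integer $t\ge0$ let $$\mathbf{w}_t=\frac1{t+1}\sum_{k=0}^{t}w^{k+1},\qquad \mathbf{u}_t=\frac1{t+1}\sum_{k=0}^{t}u^{k+1}.$$ Then $$\phi(\mathbf{u}_t)-\phi(u)+\langle \mathbf{w}_t-w,\mathcal{J}(w)\rangle\le\frac{1}{2(t+1)}\|w^0-w\|_G^2\qquad\text{for all } w=(x,y,\lambda)\in\mathcal{M},\ u=(x,y).$$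
   Context: Problem: minimize $f(x)+g(y)$ subject to $Ax+By=c$, $x\in\mathcal{X}$, $y\in\mathcal{Y}$, where $f:\mathbb{R}^m\to\mathbb{R}$ and $g:\mathbb{R}^n\to\mathbb{R}$ are closed proper convex functions (not necessarily smooth), $A\in\mathbb{R}^{l\times m}$, $B\in\mathbb{R}^{l\times n}$, $c\in\mathbb{R}^l$, and $\mathcal{X}\subset\mathbb{R}^m$, $\mathcal{Y}\subset\mathbb{R}^n$ are closed convex sets. Standing assumptions: the solution set of the problem is nonempty, and $A$ and $B$ have full column rank. Notation: for $\tau\neq0$ put $\mathcal{M}=\mathcal{X}\times\mathcal{Y}\times\mathbb{R}^l$; for $w=(x,y,\lambda)$ put $u=(x,y)$, $\phi(u)=f(x)+g(y)$ and $$\mathcal{J}(w)=\tau\begin{pmatrix}-A^T\lambda\\ -B^T\lambda\\ Ax+By-c\end{pmatrix}.$$ The proximal matrix is $$G=\begin{pmatrix}\left(\sigma+\frac{\varepsilon^2-1}{s}\right)A^TA&0&-\varepsilon A^T\\ 0&\left(\rho+\frac{\tau^2-1}{s}\right)B^TB&-\tau B^T\\ -\varepsilon A&-\tau B&s\mathbf{I}\end{pmatrix},$$ and $\|w\|_G=\sqrt{\langle w,Gw\rangle}$ (under the stated parameter conditions and rank assumptions $G$ is symmetric positive definite). $\|\cdot\|$ is the Euclidean norm and $\langle\cdot,\cdot\rangle$ the standard inner product. Algorithm (P-PPA): let $\bar\sigma=\sigma+\frac{\tau^2-1}{s}$ and $\bar\rho=\rho+\frac{\tau^2-1}{s}$.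 Choose $(x^0,y^0,\lambda^0)\in\mathbb{R}^m\times\mathbb{R}^n\times\mathbb{R}^l$ and set $\bar\lambda^0=\lambda^0-\frac{\tau+\varepsilon}{s}(Ax^0+By^0-c)$. For $k=0,1,2,\dots$ compute 1. $x^{k+1}=\arg\min_{x\in\mathcal{X}}\{f(x)+\frac{\bar\sigma}{2}\|A(x-x^k)-\frac{\tau}{\bar\sigma}\bar\lambda^k\|^2\}$; 2. $\bar\lambda^{k+\frac12}=\bar\lambda^k-\frac{\tau-\varepsilon}{s}[A(2x^{k+1}-x^k)+By^k-c]$; 3. $y^{k+1}=\arg\min_{y\in\mathcal{Y}}\{g(y)+\frac{\bar\rho}{2}\|B(y-y^k)-\frac{\tau}{\bar\rho}\bar\lambda^{k+\frac12}\|^2\}$; 4. $r^{k+1}=Ax^{k+1}+By^{k+1}-c$; 5. $\bar\lambda^{k+1}=\bar\lambda^k-\frac{\tau}{s}r^{k+1}-\frac1s[\tau A(x^{k+1}-x^k)+\varepsilon B(y^{k+1}-y^k)]$. The multiplier $\lambda^k$ is related to $\bar\lambda^k$ by $\bar\lambda^k=\lambda^k-\frac{\tau+\varepsilon}{s}(Ax^k+By^k-c)$; equivalently, $\lambda^{k+1}=\lambda^k-\frac1s[(\tau-\varepsilon)Ax^{k+1}+\varepsilon Ax^k+\tau By^k-\tau c]$. The iterate is $w^k=(x^k,y^k,\lambda^k)$. *)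

(* Defs.v *)
From HB Require Import structures.
From mathcomp Require Import all_boot all_order all_algebra.
From mathcomp Require Import all_classical all_reals all_analysis.

Set Implicit Arguments.
Unset Strict Implicit.
Unset Printing Implicit Defensive.

Import Order.TTheory GRing.Theory Num.Theory.
Import numFieldNormedType.Exports.

Local Open Scope classical_set_scope.
Local Open Scope ring_scope.

Section Euclidean.
Context {R : realType}.

Definition dotv n (u v : 'cV[R]_n) : R := \sum_i u i 0 * v i 0.

(* The library's norm `|u| on matrices is the sup norm, not the Euclidean one;
   its topology is nevertheless the usual one on R^n. *)
Definition norm2 n (u : 'cV[R]_n) : R := Num.sqrt (dotv u u).

Definition wnorm n (P : 'M[R]_n) (w : 'cV[R]_n) : R :=
  Num.sqrt (dotv w (P *m w)).

End Euclidean.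

(* z is a minimizer of F over D. *)
Definition is_argmin {R : realType} (T : Type) (D : set T) (F : T -> R) (z : T) :=
  D z /\ forall z', D z' -> F z <= F z'.

(* Closed means that the epigraph is closed. Properness (F > -oo everywhere and
   F < +oo somewhere) is built into the real-valued type of F. *)
Definition closed_proper_convex {R : realType} n (F : 'cV[R]_n -> R) :=
  closed [set p : 'cV[R]_n * R | F p.1 <= p.2] /\
  convex_function [set: 'cV[R]_n] F.

Definition full_column_rank {R : realType} l n (M : 'M[R]_(l, n)) :=
  \rank M = n.

Section Problem.
Context {R : realType} {m n l : nat}.
Variables (f : 'cV[R]_m -> R) (g : 'cV[R]_n -> R).
Variables (A : 'M[R]_(l, m)) (B : 'M[R]_(l, n)) (c : 'cV[R]_l).
Variables (X : set 'cV[R]_m) (Y : set 'cV[R]_n).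

Definition pair_xy (x : 'cV[R]_m) (y : 'cV[R]_n) : 'cV[R]_(m + n) := col_mx x y.

Definition triple_xyl (x : 'cV[R]_m) (y : 'cV[R]_n) (lam : 'cV[R]_l) :
  'cV[R]_(m + (n + l)) := col_mx x (col_mx y lam).

Definition phi (u : 'cV[R]_(m + n)) : R := f (usubmx u) + g (dsubmx u).

Definition feasible : set 'cV[R]_(m + n) :=
  [set u | [/\ X (usubmx u), Y (dsubmx u)
             & A *m usubmx u + B *m dsubmx u = c]].

Definition solution_set : set 'cV[R]_(m + n) :=
  [set u | is_argmin feasible phi u].

Definition calM : set 'cV[R]_(m + (n + l)) :=
  [set w | X (usubmx w) /\ Y (usubmx (dsubmx w))].

Definition calJ (tau : R) (w : 'cV[R]_(m + (n + l))) : 'cV[R]_(m + (n + l)) :=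
  let x := usubmx w in
  let y := usubmx (dsubmx w) in
  let lam := dsubmx (dsubmx w) in
  tau *: triple_xyl (- (A^T *m lam)) (- (B^T *m lam)) (A *m x + B *m y - c).

Definition Gmx (sigma rho s tau eps : R) : 'M[R]_(m + (n + l)) :=
  block_mx
    ((sigma + (eps ^+ 2 - 1) / s) *: (A^T *m A)) (row_mx 0 (- (eps *: A^T)))
    (col_mx 0 (- (eps *: A)))
    (block_mx
       ((rho + (tau ^+ 2 - 1) / s) *: (B^T *m B)) (- (tau *: B^T))
       (- (tau *: B)) s%:M).

(* blam is the sequence of multipliers the algorithm updates, bhalf k is its
   intermediate value of index k + 1/2, and lam is recovered from blam through
   PPPA_lam, which at k = 0 is the initialization of blam. *)
Record PPPA (sigma rho s tau eps : R)
    (x : nat -> 'cV[R]_m) (y : nat -> 'cV[R]_n) (lam : nat -> 'cV[R]_l)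
    (blam bhalf r : nat -> 'cV[R]_l)
    (bsigma := sigma + (tau ^+ 2 - 1) / s)
    (brho := rho + (tau ^+ 2 - 1) / s) : Prop := {
  PPPA_lam : forall k,
    blam k = lam k - ((tau + eps) / s) *: (A *m x k + B *m y k - c);
  PPPA_x : forall k,
    is_argmin X
      (fun z => f z + bsigma / 2
         * norm2 (A *m (z - x k) - (tau / bsigma) *: blam k) ^+ 2)
      (x k.+1);
  PPPA_half : forall k,
    bhalf k = blam k
      - ((tau - eps) / s) *: (A *m (2 *: x k.+1 - x k) + B *m y k - c);
  PPPA_y : forall k,
    is_argmin Y
      (fun z => g z + brho / 2
         * norm2 (B *m (z - y k) - (tau / brho) *: bhalf k) ^+ 2)
      (y k.+1);
  PPPA_r : forall k,
    r k.+1 = A *m x k.+1 + B *m y k.+1 - c;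
  PPPA_blam : forall k,
    blam k.+1 = blam k - (tau / s) *: r k.+1
      - s^-1 *: (tau *: (A *m (x k.+1 - x k)) + eps *: (B *m (y k.+1 - y k)))
}.

End Problem.

Definition ergodic {R : realType} n (v : nat -> 'cV[R]_n) (t : nat) : 'cV[R]_n :=
  t.+1%:R^-1 *: \sum_(0 <= k < t.+1) v k.+1.

(* Main.v *)
Require Import Defs.
From HB Require Import structures.
From mathcomp Require Import all_boot all_order all_algebra.
From mathcomp Require Import all_classical all_reals all_analysis.
From mathcomp Require Import ring lra.

Set Implicit Arguments.
Unset Strict Implicit.
Unset Printing Implicit Defensive.

Import Order.TTheory GRing.Theory Num.Theory.
Import numFieldNormedType.Exports.

Local Open Scope classical_set_scope.
Local Open Scope ring_scope.

(** The bound holds because each iteration of the algorithm is a proximal point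
    step in the metric of [G].  The optimality conditions of the two
    subproblems and the multiplier update together say that, for all [w] in [calM],
      [phi(u) - phi(u^(k+1)) + <w - w^(k+1), J(w^(k+1)) + G (w^(k+1) - w^k)> >= 0].
    The linear part of [J] is skew-symmetric, so [J(w^(k+1))] may be replaced by
    [J(w)], and polarizing the [G]-term gives the one-step estimate
      [phi(u^(k+1)) - phi(u) + <w^(k+1) - w, J(w)>
       <= 1/2 (|w^k - w|_G^2 - |w^(k+1) - w|_G^2)]
    ([PPPA_step]), where the term [- 1/2 |w^(k+1) - w^k|_G^2] has been dropped.
    Summed over [k <= t] the right-hand side telescopes, and Jensen's inequality
    for [f] and [g] ([jensen_ergodic]) passes from the average of the values to
    the value at the average.

    Every matrix in [G] and [J] acts through [A x], [B y] and [lambda], which are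
    all vectors of [R^l], and none of them mixes two coordinates of [R^l].
    Hence [|w|_G^2] is the sum over the coordinates of one quadratic form
    [qform] in three real variables ([dotv_Gmx]), and both the algebra of a
    step ([one_step_identity]) and the semidefiniteness of [G] ([qform_ge0])
    are statements about real numbers. *)

(** * Convexity and ergodic means *)

Lemma convex_functionW (R : realType) n (F : 'cV[R]_n -> R) (th : R)
    (u v : 'cV[R]_n) :
  convex_function [set: 'cV[R]_n] F -> 0 <= th -> th <= 1 ->
  F (th *: u + (1 - th) *: v) <= th * F u + (1 - th) * F v.
Proof.
move=> F_cvx th_ge0 th_le1.
by have := F_cvx (Itv01 th_ge0 th_le1) u v (mem_set I) (mem_set I).
Qed.

Lemma convex_setW01 (R : realType) n (D : set 'cV[R]_n) (th : R)
    (u v : 'cV[R]_n) :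
  convex_set D -> 0 <= th -> th <= 1 -> D u -> D v ->
  D (th *: u + (1 - th) *: v).
Proof.
move=> D_cvx th_ge0 th_le1 Du Dv.
by have /set_mem := D_cvx u v (Itv01 th_ge0 th_le1) (mem_set Du) (mem_set Dv).
Qed.

Lemma ergodicS (R : realType) n (v : nat -> 'cV[R]_n) t :
  ergodic v t.+1 =
  (t.+1%:R / t.+2%:R) *: ergodic v t + (1 - t.+1%:R / t.+2%:R) *: v t.+2.
Proof.
have t1_neq0 : t.+1%:R != 0 :> R by rewrite pnatr_eq0.
have t2_neq0 : t.+2%:R != 0 :> R by rewrite pnatr_eq0.
rewrite /ergodic big_nat_recr //= scalerDr scalerA; congr (_ *: _ + _ *: _).
  by move: t1_neq0 t2_neq0; set a := t.+1%:R; set b := t.+2%:R => ? ?; field;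
     apply/andP.
apply: (mulIf t2_neq0).
by rewrite mulVf// mulrBl mulfVK// mul1r -natrB// subSnn.
Qed.

(** Induction on [t], the mean of [t + 2] vectors being a convex combination of
    the mean of the first [t + 1] and the last one. *)
Lemma jensen_ergodic (R : realType) n (F : 'cV[R]_n -> R)
    (v : nat -> 'cV[R]_n) t :
  convex_function [set: 'cV[R]_n] F ->
  F (ergodic v t) <= t.+1%:R^-1 * \sum_(0 <= k < t.+1) F (v k.+1).
Proof.
move=> F_cvx; elim: t => [|t IH].
  by rewrite /ergodic !big_nat1 invr1 scale1r mul1r.
rewrite ergodicS big_nat_recr //=.
have t1_neq0 : t.+1%:R != 0 :> R by rewrite pnatr_eq0.
have t2_neq0 : t.+2%:R != 0 :> R by rewrite pnatr_eq0.
have th_ge0 : 0 <= t.+1%:R / t.+2%:R :> R by rewrite divr_ge0.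
have th_le1 : t.+1%:R / t.+2%:R <= 1 :> R.
  by rewrite ler_pdivrMr ?ltr0n// mul1r ler_nat.
apply: (le_trans (convex_functionW _ _ F_cvx th_ge0 th_le1)).
have -> : t.+2%:R^-1 * (\sum_(0 <= k < t.+1) F (v k.+1) + F (v t.+2)) =
    t.+1%:R / t.+2%:R * (t.+1%:R^-1 * \sum_(0 <= k < t.+1) F (v k.+1))
    + (1 - t.+1%:R / t.+2%:R) * F (v t.+2).
  by move: t1_neq0 t2_neq0; set a := t.+1%:R; set b := t.+2%:R => ? ?; field;
     apply/andP.
by rewrite lerD2r ler_wpM2l.
Qed.

(** * First-order optimality *)

Lemma ge0_of_perturbation (R : realType) (p q : R) : 0 <= q ->
  (forall th : R, 0 < th -> th <= 1 -> 0 <= p + th * q) -> 0 <= p.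
Proof.
move=> q_ge0 pq; rewrite leNgt; apply/negP => p_lt0.
(* The parameter th = - p / (q - p) makes p + th * q negative. *)
have d_gt0 : 0 < q - p by lra.
have h1 : 0 < - p / (q - p) by rewrite divr_gt0// oppr_gt0.
have h2 : - p / (q - p) <= 1 by rewrite ler_pdivrMr// mul1r; lra.
have := pq _ h1 h2.
have -> : p + - p / (q - p) * q = - (p ^+ 2) / (q - p).
  by field; rewrite gt_eqF.
by rewrite pmulr_lge0 ?invr_gt0// oppr_ge0 leNgt exprn_even_gt0 //= lt_eqF.
Qed.

Lemma norm2_sqr (R : realType) n (u : 'cV[R]_n) : norm2 u ^+ 2 = dotv u u.
Proof.
by rewrite /norm2 sqr_sqrtr// /dotv sumr_ge0// => i _; rewrite -expr2 sqr_ge0.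
Qed.

(** Comparing [z] with the point [z + th (z' - z)] of [D] and using convexity
    of [F] leaves, after division by [th], a bound with an error of order [th],
    which vanishes as [th] tends to [0].  Pairing in the image
    of [M] absorbs the factor [M^T] of the gradient of the penalty. *)
Lemma argmin_variational (R : realType) l n (F : 'cV[R]_n -> R)
    (D : set 'cV[R]_n) (M : 'M[R]_(l, n)) (beta tau : R) (v : 'cV[R]_l)
    (z0 z : 'cV[R]_n) :
  convex_function [set: 'cV[R]_n] F -> convex_set D -> 0 < beta ->
  is_argmin D
    (fun z' => F z' + beta / 2
       * norm2 (M *m (z' - z0) - (tau / beta) *: v) ^+ 2) z ->
  forall z', D z' ->
  F z - F z' <=
  dotv (M *m z' - M *m z) (beta *: (M *m z - M *m z0) - tau *: v).
Proof.
move=> F_cvx D_cvx beta_gt0 [Dz z_min] z' Dz'.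
set d := M *m z' - M *m z; rewrite -subr_ge0.
apply: (@ge0_of_perturbation _ _ (beta / 2 * dotv d d)).
  by rewrite -norm2_sqr mulr_ge0 ?sqr_ge0// divr_ge0// ltW.
move=> th th_gt0 th_le1; have th_ge0 := ltW th_gt0.
have := z_min _ (convex_setW01 D_cvx th_ge0 th_le1 Dz' Dz).
have := convex_functionW z' z F_cvx th_ge0 th_le1.
rewrite !norm2_sqr.
set zt := th *: z' + _.
set e := dotv d _.
have -> : dotv (M *m (zt - z0) - (tau / beta) *: v)
    (M *m (zt - z0) - (tau / beta) *: v) =
    dotv (M *m (z - z0) - (tau / beta) *: v)
    (M *m (z - z0) - (tau / beta) *: v)
    + 2 * th / beta * e + th ^+ 2 * dotv d d.
  rewrite /e /dotv !mulr_sumr -!big_split /=; apply: eq_bigr => i _.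
  have -> : (M *m (zt - z0) - (tau / beta) *: v) i 0 =
      (M *m (z - z0) - (tau / beta) *: v) i 0 + th * d i 0.
    by rewrite /d /zt !(mulmxBr, mulmxDr) -!scalemxAr !mxE; ring.
  rewrite mulmxBr !mxE; field; exact: lt0r_neq0.
move=> cvx opt; rewrite -(pmulr_rge0 _ th_gt0).
set N := dotv (M *m (z - z0) - _) _ in opt.
have -> : th * (e - (F z - F z') + th * (beta / 2 * dotv d d)) =
   th * F z' + (1 - th) * F z
   + beta / 2 * (N + 2 * th / beta * e + th ^+ 2 * dotv d d)
   - (F z + beta / 2 * N).
  by field; exact: lt0r_neq0.
by rewrite subr_ge0; apply: (le_trans opt); rewrite lerD2r.
Qed.

(** * The metric in one coordinate *)

(** The quadratic form of [G] on one coordinate of [(A x, B y, lambda)]; [p] and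
    [q] stand for the coefficients of the two diagonal blocks. *)
Definition qform (R : realType) (p q s tau eps a b lam : R) : R :=
  p * a ^+ 2 + q * b ^+ 2 + s * lam ^+ 2
  - 2 * eps * a * lam - 2 * tau * b * lam.

(** Complete the square in [lam], then in [a]: what remains is a multiple of
    [b ^+ 2] whose sign is that of the determinant condition on the
    parameters. *)
Lemma qform_ge0 (R : realType) (sigma rho s tau eps a b lam : R) :
  0 < s -> 1 / s < sigma ->
  (sigma * s - 1) * (rho * s - 1) - tau ^+ 2 * eps ^+ 2 > 0 ->
  0 <= qform (sigma + (eps ^+ 2 - 1) / s) (rho + (tau ^+ 2 - 1) / s)
         s tau eps a b lam.
Proof.
move=> s_gt0 sigma_gt par.
have p_gt0 : 0 < sigma * s - 1 by move: sigma_gt; rewrite ltr_pdivrMr// subr_gt0.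
have -> : qform (sigma + (eps ^+ 2 - 1) / s) (rho + (tau ^+ 2 - 1) / s)
         s tau eps a b lam =
   ((s * lam - eps * a - tau * b) ^+ 2
    + (((sigma * s - 1) * a - eps * tau * b) ^+ 2
       + ((sigma * s - 1) * (rho * s - 1) - tau ^+ 2 * eps ^+ 2) * b ^+ 2)
      / (sigma * s - 1)) / s.
  by rewrite /qform; field; rewrite !lt0r_neq0.
apply: divr_ge0; last exact: ltW.
apply: addr_ge0; first exact: sqr_ge0.
apply: divr_ge0; last exact: ltW.
by apply: addr_ge0; [exact: sqr_ge0|rewrite mulr_ge0 ?sqr_ge0 ?ltW].
Qed.

(** The left-hand side is the sum of the bounds on [f] and [g] given by the
    subproblems and of the pairing with [J(w')].  Since the linear part of [J]
    is skew-symmetric, that sum is [<w' - w1, G (w1 - w)>], and polarizing it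
    gives the three forms on the right. *)
Lemma one_step_identity (R : realType)
   (sigma rho s tau eps a b lam a1 b1 a' b' lam' c : R)
   (p := sigma + (eps ^+ 2 - 1) / s) (q := rho + (tau ^+ 2 - 1) / s)
   (bsigma := sigma + (tau ^+ 2 - 1) / s)
   (blam := lam - (tau + eps) / s * (a + b - c))
   (bhalf := blam - (tau - eps) / s * (2 * a1 - a + b - c))
   (lam1 := lam - s^-1 * ((tau - eps) * a1 + eps * a + tau * b - tau * c)) :
  s != 0 ->
  (a' - a1) * (bsigma * (a1 - a) - tau * blam)
  + (b' - b1) * (q * (b1 - b) - tau * bhalf)
  + tau * ((lam1 - lam') * (a' + b' - c) - (a1 - a') * lam' - (b1 - b') * lam')
  = 2^-1 * (qform p q s tau eps (a - a') (b - b') (lam - lam')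
            - qform p q s tau eps (a1 - a') (b1 - b') (lam1 - lam')
            - qform p q s tau eps (a1 - a) (b1 - b) (lam1 - lam)).
Proof.
move=> s_neq0; rewrite /lam1 /bhalf /blam /bsigma /p /q /qform.
by field.
Qed.

(** * The pairings in coordinates *)

Section Dotv.
Context {R : realType}.

Lemma dotv_mulmx k n (M : 'M[R]_(k, n)) (u : 'cV[R]_n) (v : 'cV[R]_k) :
  dotv u (M^T *m v) = dotv (M *m u) v.
Proof.
have dotvE p (a b : 'cV[R]_p) : dotv a b = (a^T *m b) 0 0.
  by rewrite mxE; apply: eq_bigr => i _; rewrite mxE.
by rewrite !dotvE trmx_mul mulmxA.
Qed.

Lemma dotv_col_mx p q (a : 'cV[R]_p) (b : 'cV[R]_q) a' b' :
  dotv (col_mx a b) (col_mx a' b') = dotv a a' + dotv b b'.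
Proof.
rewrite /dotv big_split_ord /=.
by congr (_ + _); apply: eq_bigr => i _; rewrite ?col_mxEu ?col_mxEd.
Qed.

Lemma dotvDr n (u v w : 'cV[R]_n) : dotv u (v + w) = dotv u v + dotv u w.
Proof.
by rewrite /dotv -big_split; apply: eq_bigr => i _; rewrite mxE mulrDr.
Qed.

Lemma dotvZr n (k : R) (u v : 'cV[R]_n) : dotv u (k *: v) = k * dotv u v.
Proof.
by rewrite /dotv mulr_sumr; apply: eq_bigr => i _; rewrite mxE mulrCA.
Qed.

Lemma dotvNr n (u v : 'cV[R]_n) : dotv u (- v) = - dotv u v.
Proof. by rewrite -scaleN1r dotvZr mulN1r. Qed.

Lemma dotv_ergodicB n (v : nat -> 'cV[R]_n) (w z : 'cV[R]_n) t :
  dotv (ergodic v t - w) z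
  = t.+1%:R^-1 * \sum_(0 <= k < t.+1) dotv (v k.+1 - w) z.
Proof.
have t1_neq0 : t.+1%:R != 0 :> R by rewrite pnatr_eq0.
have -> : ergodic v t - w
    = t.+1%:R^-1 *: \sum_(0 <= k < t.+1) (v k.+1 - w).
  rewrite sumrB scalerBr sumr_const_nat subn0 -[w *+ _]scaler_nat scalerA mulVf//.
  by rewrite scale1r.
rewrite /dotv exchange_big mulr_sumr; apply: eq_bigr => i _.
by rewrite mxE summxE -mulrA mulr_suml.
Qed.

End Dotv.

Lemma triple_xylB (R : realType) m n l (a a' : 'cV[R]_m) (b b' : 'cV[R]_n)
    (c c' : 'cV[R]_l) :
  triple_xyl a b c - triple_xyl a' b' c' = triple_xyl (a - a') (b - b') (c - c').
Proof. by rewrite /triple_xyl !opp_col_mx !add_col_mx. Qed.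

Lemma dotv_calJ (R : realType) m n l (A : 'M[R]_(l, m)) (B : 'M[R]_(l, n))
    (c : 'cV[R]_l) (tau : R) dx dy dl x y lam :
  dotv (triple_xyl dx dy dl) (calJ A B c tau (triple_xyl x y lam))
  = \sum_i tau * (dl i 0 * ((A *m x) i 0 + (B *m y) i 0 - c i 0)
      - (A *m dx) i 0 * lam i 0 - (B *m dy) i 0 * lam i 0).
Proof.
rewrite /calJ /triple_xyl !(col_mxKu, col_mxKd) dotvZr !dotv_col_mx.
rewrite !dotvNr !dotv_mulmx -mulr_sumr /dotv -!sumrN -!big_split /=.
by congr (_ * _); apply: eq_bigr => i _; rewrite [(_ - c) i 0]mxE !mxE; ring.
Qed.

Lemma dotv_Gmx (R : realType) m n l (A : 'M[R]_(l, m)) (B : 'M[R]_(l, n))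
    (sigma rho s tau eps : R) x y lam :
  dotv (triple_xyl x y lam)
    (Gmx A B sigma rho s tau eps *m triple_xyl x y lam)
  = \sum_i qform (sigma + (eps ^+ 2 - 1) / s) (rho + (tau ^+ 2 - 1) / s)
      s tau eps ((A *m x) i 0) ((B *m y) i 0) (lam i 0).
Proof.
rewrite /Gmx /triple_xyl mul_block_col mul_row_col mul_col_mx mul_block_col.
rewrite mul0mx add0r add_col_mx !dotv_col_mx mul_scalar_mx !mulNmx -!scalemxAl.
rewrite mul0mx add0r -!mulmxA !dotvDr !dotvNr !dotvZr !dotv_mulmx.
rewrite /qform !(big_split, sumrB, sumrN) /=.
rewrite /dotv !mulr_sumr -!sumrN -!big_split /=.
by apply: eq_bigr => i _; ring.
Qed.

(** * One iteration *)

Lemma penalty_gt0 (R : realType) (th s tau : R) :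
  0 < s -> 0 < th * s - 1 -> 0 < th + (tau ^+ 2 - 1) / s.
Proof.
move=> s_gt0 th_gt0.
have -> : th + (tau ^+ 2 - 1) / s = (th * s - 1 + tau ^+ 2) / s.
  by field; exact: lt0r_neq0.
by rewrite divr_gt0// ltr_wpDr ?sqr_ge0.
Qed.

Section OneIteration.
Context {R : realType} {m n l : nat}.
Variables (f : 'cV[R]_m -> R) (g : 'cV[R]_n -> R).
Variables (A : 'M[R]_(l, m)) (B : 'M[R]_(l, n)) (c : 'cV[R]_l).
Variables (X : set 'cV[R]_m) (Y : set 'cV[R]_n).
Variables (sigma rho s tau eps : R).
Variables (x : nat -> 'cV[R]_m) (y : nat -> 'cV[R]_n).
Variables (lam blam bhalf r : nat -> 'cV[R]_l).
Hypothesis gen : PPPA f g A B c X Y sigma rho s tau eps x y lam blam bhalf r.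
Hypothesis s_gt0 : 0 < s.

(** Eliminating [blam]: written in [lam], the update is the equation
    [tau (A x^(k+1) + B y^(k+1) - c) + (G (w^(k+1) - w^k))_lambda = 0], the last
    block of the proximal step. *)
Lemma PPPA_lamS k :
  lam k.+1 = lam k - s^-1 *: ((tau - eps) *: (A *m x k.+1)
    + eps *: (A *m x k) + tau *: (B *m y k) - tau *: c).
Proof.
have := PPPA_blam gen k.
rewrite !(PPPA_lam gen) (PPPA_r gen) => /eqP; rewrite subr_eq => /eqP ->.
apply/matrixP => i j; rewrite !mulmxBr !mxE.
by field; exact: lt0r_neq0.
Qed.

Hypothesis f_cvx : convex_function [set: 'cV[R]_m] f.
Hypothesis g_cvx : convex_function [set: 'cV[R]_n] g.
Hypothesis X_cvx : convex_set X.
Hypothesis Y_cvx : convex_set Y.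
Hypothesis sigma_gt : 1 / s < sigma.
Hypothesis params_gt0 :
  0 < (sigma * s - 1) * (rho * s - 1) - tau ^+ 2 * eps ^+ 2.

Let G := Gmx A B sigma rho s tau eps.
Let w_ k := triple_xyl (x k) (y k) (lam k).

Lemma Gmx_ge0 (z : 'cV[R]_m) (v : 'cV[R]_n) (mu : 'cV[R]_l) :
  0 <= dotv (triple_xyl z v mu) (G *m triple_xyl z v mu).
Proof. by rewrite dotv_Gmx sumr_ge0// => i _; exact: qform_ge0. Qed.

Lemma PPPA_step x' y' lam' (w := triple_xyl x' y' lam') k : X x' -> Y y' ->
  f (x k.+1) - f x' + (g (y k.+1) - g y')
    + dotv (w_ k.+1 - w) (calJ A B c tau w)
  <= 2^-1 * (dotv (w_ k - w) (G *m (w_ k - w))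
             - dotv (w_ k.+1 - w) (G *m (w_ k.+1 - w))).
Proof.
move=> Xx' Yy'.
have sig_gt0 : 0 < sigma * s - 1.
  by move: sigma_gt; rewrite ltr_pdivrMr// subr_gt0.
have rho_gt0 : 0 < rho * s - 1.
  rewrite -(pmulr_rgt0 _ sig_gt0).
  apply: le_lt_trans (_ : tau ^+ 2 * eps ^+ 2 < _); last by rewrite -subr_gt0.
  by rewrite mulr_ge0 ?sqr_ge0.
have hx := argmin_variational f_cvx X_cvx
  (penalty_gt0 tau s_gt0 sig_gt0) (PPPA_x gen k) Xx'.
have hy := argmin_variational g_cvx Y_cvx
  (penalty_gt0 tau s_gt0 rho_gt0) (PPPA_y gen k) Yy'.
apply: (le_trans (lerD (lerD hx hy) (lexx _))).
rewrite /w_ /w !triple_xylB dotv_calJ !dotv_Gmx.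
rewrite /dotv -sumrB mulr_sumr -!big_split /=; apply: ler_sum => i _.
rewrite (PPPA_half gen) (PPPA_lam gen) PPPA_lamS !mulmxBr -!scalemxAr.
have := one_step_identity sigma rho tau eps ((A *m x k) i 0) ((B *m y k) i 0)
  (lam k i 0) ((A *m x k.+1) i 0) ((B *m y k.+1) i 0) ((A *m x') i 0)
  ((B *m y') i 0) (lam' i 0) (c i 0) (lt0r_neq0 s_gt0).
rewrite !mxE => ->.
by rewrite ler_pM2l ?invr_gt0// gerBl; exact: qform_ge0.
Qed.

End OneIteration.

(** * The ergodic estimate *)

Theorem theorem2 (R : realType) (m n l : nat)
  (f : 'cV[R]_m -> R) (g : 'cV[R]_n -> R)
  (A : 'M[R]_(l, m)) (B : 'M[R]_(l, n)) (c : 'cV[R]_l)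
  (X : set 'cV[R]_m) (Y : set 'cV[R]_n)
  (f_cpc : closed_proper_convex f) (g_cpc : closed_proper_convex g)
  (X_closed : closed X) (X_convex : convex_set X)
  (Y_closed : closed Y) (Y_convex : convex_set Y)
  (sol_nonempty : solution_set f g A B c X Y !=set0)
  (A_rank : full_column_rank A) (B_rank : full_column_rank B)
  (sigma rho s tau eps : R)
  (s_gt0 : 0 < s) (sigma_gt : 1 / s < sigma)
  (params_gt0 : (sigma * s - 1) * (rho * s - 1) - tau ^+ 2 * eps ^+ 2 > 0)
  (tau_neq0 : tau != 0)
  (x : nat -> 'cV[R]_m) (y : nat -> 'cV[R]_n) (lam : nat -> 'cV[R]_l)
  (blam bhalf r : nat -> 'cV[R]_l)
  (gen : PPPA f g A B c X Y sigma rho s tau eps x y lam blam bhalf r)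
  (w_ := fun k => triple_xyl (x k) (y k) (lam k))
  (u_ := fun k => pair_xy (x k) (y k))
  (t : nat) :
  forall (x' : 'cV[R]_m) (y' : 'cV[R]_n) (lam' : 'cV[R]_l)
    (w := triple_xyl x' y' lam') (u := pair_xy x' y'),
    calM X Y w ->
    phi f g (ergodic u_ t) - phi f g u
      + dotv (ergodic w_ t - w) (calJ A B c tau w)
    <= 1 / (2 * t.+1%:R)
       * wnorm (Gmx A B sigma rho s tau eps) (w_ 0%N - w) ^+ 2.
Proof.
move=> x' y' lam' w u [Xx' Yy'].
rewrite /w /triple_xyl !(col_mxKu, col_mxKd) in Xx' Yy'.
case: f_cpc g_cpc => _ f_cvx [_ g_cvx].
pose Q k := dotv (w_ k - w) (Gmx A B sigma rho s tau eps *m (w_ k - w)).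
have Q_ge0 k : 0 <= Q k by rewrite /Q /w_ triple_xylB Gmx_ge0.
have step k := PPPA_step gen s_gt0 f_cvx g_cvx X_convex Y_convex sigma_gt
  params_gt0 lam' k Xx' Yy'.
have total : \sum_(0 <= k < t.+1) (f (x k.+1) - f x' + (g (y k.+1) - g y')
    + dotv (w_ k.+1 - w) (calJ A B c tau w)) <= 2^-1 * Q 0%N.
  apply: (le_trans (ler_sum _ (fun k _ => step k))).
  rewrite -mulr_sumr ler_wpM2l ?invr_ge0//.
  rewrite (@telescope_sumr_eq _ _ _ (fun k => - Q k)) //; last first.
    by move=> k _; rewrite opprK addrC.
  by rewrite opprK gerDr oppr_le0.
rewrite !big_split /= !sumrN !sumr_const_nat subn0 in total.
rewrite /wnorm sqr_sqrtr; last exact: (Q_ge0 0%N).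
have -> : phi f g (ergodic u_ t) = f (ergodic x t) + g (ergodic y t).
  by congr (f _ + g _); rewrite /ergodic !linearZ linear_sum /=;
     congr (_ *: _); apply: eq_bigr => k _; rewrite (col_mxKu, col_mxKd).
rewrite /phi /u /pair_xy col_mxKu col_mxKd dotv_ergodicB.
have t1_gt0 : 0 < t.+1%:R :> R by rewrite ltr0n.
have divide (F G D p q z : R) :
    F - p *+ t.+1 + (G - q *+ t.+1) + D <= 2^-1 * z ->
    t.+1%:R^-1 * F + t.+1%:R^-1 * G - (p + q) + t.+1%:R^-1 * D
    <= 1 / (2 * t.+1%:R) * z.
  rewrite -(mulr_natl p) -(mulr_natl q); move: t1_gt0; set T := t.+1%:R => T_gt0.
  rewrite -(ler_pM2l (_ : 0 < T^-1)) ?invr_gt0//.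
  by congr (_ <= _); field; exact: lt0r_neq0.
apply: le_trans (divide _ _ _ _ _ _ total).
by rewrite !lerD2r lerD// jensen_ergodic.
Qed.
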